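(* Let $a>0$, $g>0$, $\delta>0$, and consider a network with nominal Laplacian eigenvalues $0=\lambda_1<\lambda_2\le\cdots\le\lambda_N$, maximum link coefficient of dispersion $\bar\gamma$ and parameter $\tau$, as described in the context. Put $a_0=a-\frac1\delta$, $\lambda_{sup}=\underset{\lambda\in\{\lambda_2,\lambda_N\}}{\operatorname{argmax}}\left|\lambda+\bar\gamma\tau-\frac{a_0}{g}\right|$ and $\alpha_0^2=(a_0-\lambda_{sup}g)^2+2\bar\gamma\tau\lambda_{sup}g^2$. Then the condition that there exists a positive constant $p<\delta$ satisfying $$\left(p-\frac1\delta\right)\left(\frac1p-\frac1\delta\right)>\alpha_0^2$$ is equivalent to $$\left(1-\frac1\delta\right)^2>\alpha_0^2=(a_0-\lambda_{sup}g)^2+2\bar\gamma\tau\lambda_{sup}g^2.$$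
   Context: $\mathcal L$ is the weighted Laplacian of an undirected graph on $N$ nodes with edge set $\mathcal E$ and edge weights $\mu_{ij}>0$, with eigenvalues $0=\lambda_1<\lambda_2\le\cdots\le\lambda_N$. $\mathcal E_U\subseteq\mathcal E$ is a set of uncertain edges, each edge $e_{ij}\in\mathcal E_U$ having a random weight with mean $\mu_{ij}$ and variance $\sigma_{ij}^2$, and $\mathcal E_D=\mathcal E\setminus\mathcal E_U$. The coefficient of dispersion of an uncertain link is $\gamma_{ij}=\sigma_{ij}^2/\mu_{ij}$, and $\bar\gamma=\max\gamma_{ij}$ over the uncertain links. $\tau=\frac{\lambda_{N_U}}{\lambda_{N_U}+\lambda_{2_D}}$, where $\lambda_{N_U}$ is the maximum eigenvalue of the Laplacian $\mathcal L_U$ with edge set $\mathcal E_U$ and $\lambda_{2_D}$ is the second-smallest eigenvalue of the Laplacian $\mathcal L_D$ with edge set $\mathcal E_D$, both on the full node set with weights $\mu_{ij}$. (In the source, $a$ and $\delta$ come from subsystem dynamics $x_{t+1}=ax_t-\phi(x_t)+v_t$ with $\phi$ monotonic and globally Lipschitz with constant $2/\delta$, and $g$ is the coupling gain.)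
   Formalization: The formal theorem assumes δ ≥ 1 in place of δ > 0; for δ < 1 the claim fails, since no positive p < δ can satisfy the first inequality while the second can hold (e.g. two nodes, one uncertain edge, μ = 1, σ² = 1/2, δ = 1/2, a = 3, g = 1/2). *)

(* Defs.v *)
(* MathComp / MathComp-Analysis *)
From HB Require Import structures.
From mathcomp Require Import all_boot all_order all_algebra.
From mathcomp Require Import all_classical all_reals all_analysis.
Set Implicit Arguments.
Unset Strict Implicit.
Unset Printing Implicit Defensive.
Import Order.TTheory GRing.Theory Num.Theory.
Local Open Scope ring_scope.

(* Edges are unordered pairs, encoded by symmetric relations; data attached to
   an edge are functions of two nodes, constrained only on edges. *)
Record uncertain_network d (T : measurableType d) (R : realType)
    (P : probability T R) (n : nat) := UncertainNetwork {
  edge : rel 'I_n;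
  edge_sym : symmetric edge;
  edge_irr : irreflexive edge;
  edgeU : rel 'I_n;
  edgeU_sym : symmetric edgeU;
  edgeU_sub : subrel edgeU edge;
  mu : 'I_n -> 'I_n -> R;
  mu_sym : forall i j, edge i j -> mu i j = mu j i;
  mu_gt0 : forall i j, edge i j -> 0 < mu i j;
  weight : 'I_n -> 'I_n -> {RV P >-> R};
  weight_sym : forall i j, edgeU i j -> weight i j = weight j i;
  sigma : 'I_n -> 'I_n -> R;
  weight_mean : forall i j, edgeU i j -> ('E_P[weight i j] = (mu i j)%:E)%E;
  weight_var : forall i j, edgeU i j ->
    ('V_P[weight i j] = (sigma i j ^+ 2)%:E)%E
}.

Definition laplacian (R : realType) (n : nat) (e : rel 'I_n)
    (w : 'I_n -> 'I_n -> R) : 'M[R]_n :=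
  \matrix_(i, j) (if i == j then \sum_(k | e i k) w i k
                  else if e i j then - w i j else 0).

(* s lists the eigenvalues of A in nondecreasing order, with multiplicity, so
   that the k-th smallest eigenvalue is s`_(k-1). *)
Definition is_spectrum (R : realType) (n : nat) (A : 'M[R]_n) (s : seq R) :=
  sorted <=%R s /\ char_poly A = \prod_(x <- s) ('X - x%:P).

Definition is_argmax (R : realType) (s : seq R) (f : R -> R) (x : R) :=
  x \in s /\ forall y, y \in s -> f y <= f x.

Section Network.
Variables (d : measure_display) (T : measurableType d) (R : realType).
Variables (P : probability T R) (n : nat) (G : uncertain_network P n).

Definition edgeD : rel 'I_n := fun i j => edge G i j && ~~ edgeU G i j.

Definition lap := laplacian (edge G) (mu G).
Definition lapU := laplacian (edgeU G) (mu G).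
Definition lapD := laplacian edgeD (mu G).

Definition dispersion (i j : 'I_n) : R := sigma G i j ^+ 2 / mu G i j.

(* Dispersions are nonnegative, so the base value 0 only matters when there is
   no uncertain link, in which case it is the value taken. *)
Definition max_dispersion : R :=
  \big[Num.max/0]_(ij : 'I_n * 'I_n | edgeU G ij.1 ij.2) dispersion ij.1 ij.2.

End Network.

(* Main.v *)
Require Import Defs.
From HB Require Import structures.
From mathcomp Require Import all_boot all_order all_algebra.
From mathcomp Require Import all_classical all_reals all_analysis.
From mathcomp Require Import ring.
Import Order.TTheory GRing.Theory Num.Theory.
Local Open Scope ring_scope.

(** With b = 1/delta, the identity
      (p - b)(1/p - b) = (1 - b)^2 - b (p - 1)^2 / p
    shows that the left-hand side is maximal at p = 1. This point is admissible
    when delta > 1; when delta = 1 it is the excluded endpoint, the supremum 0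
    is not attained, but the inequalities are strict, so that any value below
    the supremum is still exceeded at some p < 1. *)

Lemma sub_mul_subV (F : fieldType) (p b : F) : p != 0 ->
  (p - b) * (p^-1 - b) = (1 - b) ^+ 2 - b * ((p - 1) ^+ 2 / p).
Proof. by move=> p0; field. Qed.

Lemma sub_mul_subV_le (F : realFieldType) (p b : F) : 0 < p -> 0 <= b ->
  (p - b) * (p^-1 - b) <= (1 - b) ^+ 2.
Proof.
move=> p0 b0; rewrite sub_mul_subV ?gt_eqF// gerBl.
by rewrite mulr_ge0// divr_ge0 ?sqr_ge0// ltW.
Qed.

(** The threshold [c] stands for [alpha0sq]. The forward direction is the upper bound at
    [b = delta^-1]; only the converse needs a witness. *)
Lemma exists_sub_mul_subV_gt (F : realFieldType) (delta c : F) : 1 <= delta ->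
  (exists p, [/\ 0 < p, p < delta & c < (p - delta^-1) * (p^-1 - delta^-1)])
  <-> c < (1 - delta^-1) ^+ 2.
Proof.
move=> delta1; split=> [[p [p0 _ /lt_le_trans]]|].
  by apply; apply: sub_mul_subV_le; rewrite // invr_ge0 (le_trans ler01).
move: delta1; rewrite le_eqVlt => /predU1P[<-|delta1 hc].
  rewrite invr1 subrr expr0n /= => c0.
  have c1 : 0 < 1 - c by rewrite subr_gt0 (lt_trans c0).
  (* This [p] solves [p^-1 - 1 = - c], and then [p - 1 = c / (1 - c)]. The product is [c] times the
     ratio [- c / (1 - c)], which is below 1; since [c < 0], the product exceeds [c]. *)
  exists (1 - c)^-1; split; first by rewrite invr_gt0.
    by rewrite invf_lt1// ltrBrDr gtrDl.
  have -> : ((1 - c)^-1 - 1) * ((1 - c)^-1^-1 - 1) = c * (- c / (1 - c)).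
    by field; rewrite gt_eqF.
  by rewrite ltr_nMr// ltr_pdivrMr// mul1r ltrDr.
by exists 1; rewrite invr1 -expr2.
Qed.

Theorem mainTheorem2 (d : measure_display) (T : measurableType d)
    (R : realType) (P : probability T R) (n : nat) (hn : (2 <= n)%N)
    (G : uncertain_network P n)
    (lam lamU lamD : seq R)
    (hlam : is_spectrum (lap G) lam)
    (hlamU : is_spectrum (lapU G) lamU)
    (hlamD : is_spectrum (lapD G) lamD)
    (hlam1 : lam`_0 = 0) (hlam2 : 0 < lam`_1)
    (a g delta : R) (ha : 0 < a) (hg : 0 < g) (hdelta : 0 < delta)
    (hdelta1 : 1 <= delta) :
  let gammabar := max_dispersion G in
  let tau := lamU`_n.-1 / (lamU`_n.-1 + lamD`_1) in
  let a0 := a - delta^-1 in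
  forall lamsup : R,
  is_argmax [:: lam`_1; lam`_n.-1]
    (fun l => `|l + gammabar * tau - a0 / g|) lamsup ->
  let alpha0sq := (a0 - lamsup * g) ^+ 2
                  + 2 * gammabar * tau * lamsup * g ^+ 2 in
  (exists p : R, [/\ 0 < p, p < delta &
     (p - delta^-1) * (p^-1 - delta^-1) > alpha0sq])
  <-> (1 - delta^-1) ^+ 2 > alpha0sq.
Proof. by move=> ? ? ? ? _ ?; apply: exists_sub_mul_subV_gt. Qed.
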